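(* The operator $\mathsf{P}$ is a bijection from the collection of traditional games to the collection of pentaform games with information-set situations. Its inverse is the restriction of the operator $\mathsf{T}$ to the collection of pentaform games with information-set situations.
   Context: **Quintuple sets.** A quintuple $\langle i,j,w,a,y\rangle$ has arbitrary objects as components, called player, situation, decision node, action, successor node. Decision nodes and successor nodes are both nodes (the same object may occur as both). A quintuple set $Q$ is a (possibly infinite) set of quintuples. For a string of letters from $I,J,W,A,Y$, $\pi_{\cdots}(Q)$ is the projection of $Q$ onto those coordinates, in the order listed, e.g. $\pi_{JI}(Q)=\{\langle j,i\rangle\mid \exists w,a,y:\ \langle i,j,w,a,y\rangle\in Q\}$. Write $I=\pi_I(Q)$, $J=\pi_J(Q)$, $W=\pi_W(Q)$, $A=\pi_A(Q)$, $Y=\pi_Y(Q)$. For $j\in J$, the slice is $Q_j=\{\langle i_*,j_*,w_*,a_*,y_*\rangle\in Q\mid j_*=j\}$, and $W_j=\pi_W(Q_j)$. A function is identified with its graph: a set $f$ of couples such that $\langle x,z\rangle,\langle x,z'\rangle\in f$ implies $z=z'$; it is a function from its set of first coordinates. For a set $E$ of couples, $\pi_1E$ and $\pi_2E$ are its sets of first and second coordinates. **Pentaform.** A pentaform is a quintuple set $Q$ such that: [Pij] $\pi_{JI}(Q)$ is a function; [Pjw] $\pi_{WJ}(Q)$ is a function; [Pwa] for all $j\in J$, $\pi_{WA}(Q_j)$ is a Cartesian product; [Pway] $\{\langle\langle w,a\rangle,y\rangle\mid\langle w,a,y\rangle\in\pi_{WAY}(Q)\}$ is a function; [Pwy] $\pi_{YW}(Q)$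 is a function, denoted $p$; [Pay] $\pi_{YA}(Q)$ is a function; [Py] for every $y\in Y$ there is $m\ge1$ with $p^m(y)\notin Y$ (iterates of $p$ from $y$ eventually leave $Y$); [Pr] $W\smallsetminus Y$ is a singleton. **Out-trees.** A directed graph is a couple $(X,E)$ with $E\subseteq X^2$. A walk in $(X,E)$ from $w$ to $y$ is a finite sequence $\langle x_0,\dots,x_m\rangle$ in $X$, $m\ge0$, with $x_0=w$, $x_m=y$ and $\langle x_\ell,x_{\ell+1}\rangle\in E$ for all $\ell<m$. An out-tree is a directed graph $(X,E)$ for which there is $r\in X$ (necessarily unique, the root) such that for every $x\in X$ there is a unique walk from $r$ to $x$. It is nontrivial iff it has more than one node. For a nontrivial out-tree with root $r$: end nodes are the elements of $\pi_2E\smallsetminus\pi_1E$; a finite run is a walk from $r$ to an end node; an infinite run is an infinite sequence $\langle x_0,x_1,\dots\rangle$ with $x_0=r$ and $\langle x_\ell,x_{\ell+1}\rangle\in E$ for all $\ell$. A run is identified with the set of nodes it visits; $\mathcal Z$ is the collection of all runs, as subsets of $X$. **Pentaform game.** For a pentaform $Q$, $(W\cup Y,\pi_{WY}(Q))$ is a nontrivial out-tree; $\mathcal Z$ for $Q$ is the run collection of this out-tree. A pentaform game is a couple $(Q,u)$ where $Q$ is a pentaform and $u=\langle u_i:\mathcal Z\to\bar{\mathbb R}\rangle_{i\in I}$, with $\bar{\mathbb R}=\mathbb R\cup\{-\infty,\infty\}$. A quintuple set $Q$ (or a pentaform game $(Q,u)$) has information-set situations iff $W_j=j$ for all $j\in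 J$. **Traditional game.** A traditional game is a tuple $(X,E,\mathcal H,\alpha,\iota,u)$ such that: [T1] $(X,E)$ is a nontrivial out-tree; [T2] $\mathcal H$ is a partition of $\pi_1E$; [T3] $\alpha$ is a function from $E$ that is locally injective: for $\langle w,y_1\rangle,\langle w,y_2\rangle\in E$, $y_1\ne y_2$ implies $\alpha(w,y_1)\ne\alpha(w,y_2)$; [T4] with $F(w)=\{a\mid\exists y:\ \langle w,y\rangle\in E,\ \alpha(w,y)=a\}$ for $w\in\pi_1E$, one has $F(w_1)=F(w_2)$ whenever $w_1,w_2\in H\in\mathcal H$; [T5] $\iota$ is a function from $\pi_1E$ with $\iota(w_1)=\iota(w_2)$ whenever $w_1,w_2\in H\in\mathcal H$; [T6] $u=\langle u_i:\mathcal Z\to\bar{\mathbb R}\rangle_{i\in I}$, where $I=\{\iota(w)\mid w\in\pi_1E\}$ and $\mathcal Z$ is the run collection of $(X,E)$. **Operator $\mathsf P$.** $\mathsf P(X,E,\mathcal H,\alpha,\iota,u)=(\hat Q,\hat u)$ where $\hat Q=\{\langle\iota(w),H_w,w,\alpha(w,y),y\rangle\mid\langle w,y\rangle\in E\}$, with $H_w$ the cell of $\mathcal H$ containing $w$, and $\hat u=u$. **Operator $\mathsf T$.** For a pentaform game, $\mathsf T(Q,u)=(\bar X,\bar E,\bar{\mathcal H},\bar\alpha,\bar\iota,\bar u)$ where $\bar X=W\cup Y$, $\bar E=\pi_{WY}(Q)$, $\bar{\mathcal H}=\{W_j\mid j\in J\}$, $\bar\alpha=\{\langle\langle w,y\rangle,a\rangle\mid\langle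 w,y,a\rangle\in\pi_{WYA}(Q)\}$, $\bar\iota=\pi_{WI}(Q)$, $\bar u=u$. *)

(* Defs.v *)
From mathcomp Require Import all_boot.
From mathcomp Require Import boolp classical_sets functions reals constructive_ereal.

Set Implicit Arguments.
Unset Strict Implicit.
Unset Printing Implicit Defensive.

Local Open Scope classical_set_scope.

(* Functions are identified with their graphs, so that functions with proper
   domains (and hence games) can be compared by plain equality. *)
Definition is_function (T U : Type) (f : set (T * U)) : Prop :=
  forall x z z', f (x, z) -> f (x, z') -> z = z'.

Definition is_function_from (T U : Type) (f : set (T * U)) (D : set T) : Prop :=
  is_function f /\ f.`1 = D.

Definition is_product (T U : Type) (S : set (T * U)) : Prop :=
  exists (B : set T) (C : set U), S = B `*` C.

Definition is_singleton (T : Type) (S : set T) : Prop := exists r, S = [set r].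

(* [iterate p m y x] means that p^m(y) is defined and equal to x, where p is
   the graph of a partial function. *)
Fixpoint iterate (T : Type) (p : set (T * T)) (m : nat) (y x : T) : Prop :=
  if m is m'.+1 then exists z, iterate p m' y z /\ p (z, x) else x = y.

Section OutTrees.
Context {Node : Type}.
Implicit Types (X Z : set Node) (E : set (Node * Node)).

Definition digraph X E : Prop := E `<=` X `*` X.

Definition infinite_path E (r : Node) (x : nat -> Node) : Prop :=
  x 0 = r /\ forall l, E (x l, x l.+1).

(* The sequence s = <x_0, ..., x_m> has size m.+1; w is also the (irrelevant)
   default value of [nth] and [last]. *)
Definition walk X E (w y : Node) (s : seq Node) : Prop :=
  [/\ (0 < size s)%N,
      forall l, (l < size s)%N -> X (nth w s l),
      nth w s 0 = w,
      last w s = y &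
      forall l, (l.+1 < size s)%N -> E (nth w s l, nth w s l.+1)].

Definition visited (w : Node) (s : seq Node) : set Node :=
  [set x | exists2 l, (l < size s)%N & nth w s l = x].

Definition is_root X E (r : Node) : Prop :=
  X r /\ forall x, X x -> exists! s, walk X E r x s.

Definition out_tree X E : Prop := digraph X E /\ exists r, is_root X E r.

Definition nontrivial_out_tree X E : Prop :=
  out_tree X E /\ exists x x', [/\ X x, X x' & x <> x'].

Definition end_nodes E : set Node := E.`2 `\` E.`1.

Definition finite_run X E (r : Node) Z : Prop :=
  exists y s, [/\ end_nodes E y, walk X E r y s & Z = visited r s].

Definition infinite_run E (r : Node) Z : Prop :=
  exists2 x, infinite_path E r x & Z = range x.

Definition runs X E : set (set Node) :=
  [set Z | exists2 r, is_root X E r & finite_run X E r Z \/ infinite_run E r Z].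

End OutTrees.

Record quintuple (Player Sit Node Action : Type) := Quintuple {
  player : Player;
  situation : Sit;
  decision : Node;
  action : Action;
  successor : Node
}.

Section Pentaforms.
Context {Player Sit Node Action : Type}.
Implicit Type Q : set (quintuple Player Sit Node Action).

Definition pi_I Q := [set player q | q in Q].
Definition pi_J Q := [set situation q | q in Q].
Definition pi_W Q := [set decision q | q in Q].
Definition pi_A Q := [set action q | q in Q].
Definition pi_Y Q := [set successor q | q in Q].
Definition pi_JI Q := [set (situation q, player q) | q in Q].
Definition pi_WJ Q := [set (decision q, situation q) | q in Q].
Definition pi_WI Q := [set (decision q, player q) | q in Q].
Definition pi_WA Q := [set (decision q, action q) | q in Q].
Definition pi_WY Q := [set (decision q, successor q) | q in Q].
Definition pi_YW Q := [set (successor q, decision q) | q in Q].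
Definition pi_YA Q := [set (successor q, action q) | q in Q].
Definition pi_WA_Y Q := [set ((decision q, action q), successor q) | q in Q].
Definition pi_WY_A Q := [set ((decision q, successor q), action q) | q in Q].

Definition slice Q (j : Sit) := [set q | Q q /\ situation q = j].

Record pentaform Q : Prop := Pentaform {
  Pij : is_function (pi_JI Q);
  Pjw : is_function (pi_WJ Q);
  Pwa : forall j, pi_J Q j -> is_product (pi_WA (slice Q j));
  Pway : is_function (pi_WA_Y Q);
  Pwy : is_function (pi_YW Q);
  Pay : is_function (pi_YA Q);
  Py : forall y, pi_Y Q y ->
    exists m x, [/\ (1 <= m)%N, iterate (pi_YW Q) m y x & ~ pi_Y Q x];
  Pr : is_singleton (pi_W Q `\` pi_Y Q)
}.

Definition pentaform_nodes Q : set Node := pi_W Q `|` pi_Y Q.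

End Pentaforms.

(* A family <u_i : Z -> \bar R>_{i in I}, as the graph of i |-> graph of u_i. *)
Definition utility_family (R : realType) (Player Node : Type) : Type :=
  set (Player * set (set Node * \bar R)).

Definition is_utility_family (R : realType) (Player Node : Type)
    (I : set Player) (Zs : set (set Node)) (u : utility_family R Player Node) :
    Prop :=
  is_function_from u I /\ forall i ui, u (i, ui) -> is_function_from ui Zs.

Record pentaform_couple (R : realType) (Player Sit Node Action : Type) :=
  PentaformCouple {
    quintuples : set (quintuple Player Sit Node Action);
    putility : utility_family R Player Node
  }.

Definition pentaform_game (R : realType) (Player Sit Node Action : Type)
    (G : pentaform_couple R Player Sit Node Action) : Prop :=
  let Q := quintuples G in
  pentaform Q /\
  is_utility_family (pi_I Q) (runs (pentaform_nodes Q) (pi_WY Q)) (putility G).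

Definition information_set_situations (Player Node Action : Type)
    (Q : set (quintuple Player (set Node) Node Action)) : Prop :=
  forall j, pi_J Q j -> pi_W (slice Q j) = j.

Definition infoset_pentaform_game (R : realType) (Player Node Action : Type)
    (G : pentaform_couple R Player (set Node) Node Action) : Prop :=
  pentaform_game G /\ information_set_situations (quintuples G).

Record traditional_tuple (R : realType) (Player Node Action : Type) :=
  TraditionalTuple {
    nodes : set Node;
    edges : set (Node * Node);
    infosets : set (set Node);
    labels : set ((Node * Node) * Action);
    control : set (Node * Player);
    tutility : utility_family R Player Node
  }.

Definition feasible (Node Action : Type) (E : set (Node * Node))
    (alpha : set ((Node * Node) * Action)) (w : Node) : set Action :=
  [set a | exists2 y, E (w, y) & alpha ((w, y), a)].

Definition locally_injective (Node Action : Type) (E : set (Node * Node))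
    (alpha : set ((Node * Node) * Action)) : Prop :=
  forall w y1 y2 a1 a2, E (w, y1) -> E (w, y2) -> y1 <> y2 ->
    alpha ((w, y1), a1) -> alpha ((w, y2), a2) -> a1 <> a2.

Record traditional_game (R : realType) (Player Node Action : Type)
    (G : traditional_tuple R Player Node Action) : Prop := TraditionalGame {
  T1 : nontrivial_out_tree (nodes G) (edges G);
  T2 : partition (infosets G) id (edges G).`1;
  T3 : is_function_from (labels G) (edges G) /\
       locally_injective (edges G) (labels G);
  T4 : forall H w1 w2, infosets G H -> H w1 -> H w2 ->
       feasible (edges G) (labels G) w1 = feasible (edges G) (labels G) w2;
  T5 : is_function_from (control G) (edges G).`1 /\
       forall H w1 w2 i1 i2, infosets G H -> H w1 -> H w2 ->
         control G (w1, i1) -> control G (w2, i2) -> i1 = i2;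
  T6 : is_utility_family (control G).`2 (runs (nodes G) (edges G)) (tutility G)
}.

(* Both operators are defined on all tuples and are only meaningful on games:
   on a traditional game, i, H and a below are the unique objects iota(w), H_w
   and alpha(w, y). *)
Definition opP (R : realType) (Player Node Action : Type)
    (G : traditional_tuple R Player Node Action) :
    pentaform_couple R Player (set Node) Node Action :=
  PentaformCouple
    [set q | exists i H w a y,
       [/\ edges G (w, y), control G (w, i), infosets G H /\ H w,
           labels G ((w, y), a) & q = Quintuple i H w a y]]
    (tutility G).

Definition opT (R : realType) (Player Sit Node Action : Type)
    (G : pentaform_couple R Player Sit Node Action) :
    traditional_tuple R Player Node Action :=
  let Q := quintuples G in
  TraditionalTuple (pentaform_nodes Q) (pi_WY Q)
    [set pi_W (slice Q j) | j in pi_J Q] (pi_WY_A Q) (pi_WI Q) (putility G).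

(* Main.v *)
(** A set [E] of edges is the edge set of a nontrivial out-tree with root [r]
    exactly when predecessors are unique, [r] is the only node with a successor
    but no predecessor, and iterating the predecessor map from any node leads
    back to [r]; the walk from [r] to a node is then forced step by step
    backwards.  This makes [T1] for [(W `|` Y, pi_WY Q)] equivalent to
    [Pwy], [Py] and [Pr].  The other axioms match through the fact that the
    situations of [opP G] are the information sets of [G]; conversely, when
    W_j = j, passing from j to W_j in [opT] loses nothing, so the operators are
    mutually inverse. *)
Require Import Defs.
From mathcomp Require Import all_boot.
From mathcomp Require Import boolp classical_sets functions reals constructive_ereal.
Local Open Scope classical_set_scope.

Set Implicit Arguments.
Unset Strict Implicit.
Unset Printing Implicit Defensive.

(** * Out-trees described by their predecessor relation *)

Section OutTreeTheory.
Context {Node : Type}.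
Implicit Types (X : set Node) (E : set (Node * Node)) (r w x y : Node).

(** The start node stays outside the list, so every list is admissible and inductions on walks need
    no nonemptiness condition or default value. *)
Fixpoint chain E x (s : seq Node) : Prop :=
  if s is y :: s' then E (x, y) /\ chain E y s' else True.

(** The predecessor relation: for the edge set [pi_WY Q] it is the map [p] of the pentaform axioms,
    see [flip_pi_WY]. *)
Definition flip E : set (Node * Node) := [set e | E (e.2, e.1)].

Lemma chain_rcons E x s y :
  chain E x (rcons s y) <-> chain E x s /\ E (last x s, y).
Proof.
elim: s x => [|z s IH] x /=; first by split=> [[]|[]].
by split=> [[? /IH []]|[[? ?] ?]]; do ?split=> //; apply/IH.
Qed.

Lemma chainP E x s d :
  chain E x s <->
  forall l, l < size s -> E (nth d (x :: s) l, nth d (x :: s) l.+1).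
Proof.
elim: s x => [|z s IH] x /=; first by split.
split=> [[Exz /IH Es] [|l] //|Es]; first exact: Es.
by split; [exact: (Es 0)|apply/IH => l; exact: (Es l.+1)].
Qed.

(** Membership of the nodes in [X] comes for free: the first node is [x], and every later one is the
    head of an edge. *)
Lemma walkP X E x y s : digraph X E -> X x ->
  walk X E x y s <-> exists t, [/\ s = x :: t, chain E x t & last x t = y].
Proof.
move=> EX Xx; split=> [|[t [-> Et <-]]].
  case: s => [|z t] [] //= _ _ zx lasty Es; subst z.
  by exists t; split=> //; apply/(chainP _ _ _ x) => l; exact: Es.
have {}Et := (chainP _ _ _ x).1 Et.
split=> // -[|l] // lt_l.
by have /EX[] := Et l lt_l.
Qed.

(** The outermost predecessor step in [iterate] is the first edge of the chain, so both recursions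
    unfold at the same end. *)
Lemma iterate_chain E m x y :
  iterate (flip E) m y x <->
  exists t, [/\ size t = m, chain E x t & last x t = y].
Proof.
elim: m x => [|m IH] x /=.
  by split=> [->|[t [/size0nil -> _ <-]]] //; exists nil.
split=> [[z [/IH[t [st Et ly]] Exz]]|[[|z t] [] // [st] /= [Exz Et] ly]].
  by exists (z :: t); split=> //=; rewrite st.
by exists z; split=> //; apply/IH; exists t.
Qed.

(** If walks from [r] are unique, an edge into [r] would yield a second walk from [r] to [r], and
    two predecessors of a node would yield two walks to it. Conversely, two walks with the same end
    are compared backwards, and they run out together because nothing leads into [r]. *)
Lemma is_rootP X E r : digraph X E ->
  is_root X E r <->
  [/\ X r, ~ E.`2 r, is_function (flip E) &
      forall x, X x -> exists m, iterate (flip E) m x r].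
Proof.
move=> EX; split=> [[Xr walks]|[Xr rNE predE reach]].
  have reach x : X x -> exists2 t, chain E r t & last r t = x.
    move=> /walks[s [/(walkP _ _ EX Xr)[t [_ Et lt]] _]]; by exists t.
  have uniq t t' : chain E r t -> chain E r t' -> last r t = last r t' -> t = t'.
    move=> Et Et' ll.
    have Xl : X (last r t).
      elim/last_ind: t Et {ll} => [|t z _] //= /chain_rcons[_ /EX[]].
      by rewrite last_rcons.
    have [s [_ suniq]] := walks _ Xl.
    have st : s = r :: t by apply/suniq/walkP => //; exists t.
    have st' : s = r :: t' by apply/suniq/walkP => //; exists t'.
    by move: st'; rewrite st => -[].
  split=> //.
  - move=> [w Ewr]; have [t Et lt] := reach _ (EX _ Ewr).1.
    have : rcons t r = nil.
      by apply: uniq => //=; [apply/chain_rcons; rewrite lt|rewrite last_rcons].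
    by case: t {Et lt}.
  - move=> y w w' Ewy Ew'y.
    have [/reach/=[t Et lt] _] := EX _ Ewy.
    have [/reach/=[t' Et' lt'] _] := EX _ Ew'y.
    suff : rcons t y = rcons t' y by move=> /rcons_inj[tt']; rewrite -lt tt'.
    by apply: uniq; rewrite ?last_rcons //; apply/chain_rcons; rewrite ?lt ?lt'.
  - move=> x /reach[t Et lt]; exists (size t); apply/iterate_chain; by exists t.
split=> // x /reach[m /iterate_chain[t [_ Et lt]]].
exists (r :: t); split; first by apply/walkP => //; exists t.
move=> s /(walkP _ _ EX Xr)[t' [-> Et' lt']]; congr cons.
rewrite -{}lt' in lt.
(* Both lists are peeled from the end; if just one of them is empty, the other ends with an edge
   into [r]. *)
elim/last_ind: t t' Et Et' lt {m} => [|t z IH] t'; case/lastP: t' => [|t' z'] //.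
- move=> _ /chain_rcons[_ El'] /=; rewrite last_rcons => rz.
  by case: rNE; exists (last r t'); move: El'; rewrite -rz.
- move=> /chain_rcons[_ El] _ /=; rewrite last_rcons => rz.
  by case: rNE; exists (last r t); move: El; rewrite rz.
- rewrite !last_rcons => /chain_rcons[Et El] /chain_rcons[Et' El'] zz.
  by rewrite -{}zz in El' *; rewrite (IH t') //; exact: (predE z).
Qed.

(** This removes the root and the walks from the description, leaving conditions of the shape of
    [Pr], [Pwy] and [Py]. *)
Lemma nontrivial_out_treeP X E :
  nontrivial_out_tree X E <->
  [/\ X = E.`1 `|` E.`2, is_singleton (E.`1 `\` E.`2), is_function (flip E) &
      forall y, E.`2 y -> exists m x,
        [/\ (1 <= m)%N, iterate (flip E) m y x & ~ E.`2 x]].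
Proof.
split=> [[[EX [r /(is_rootP _ EX)[Xr rNE predE reach]]] [x [x' [Xx Xx' xx']]]]
        |[XE [r rE] predE reach]].
  have in2 y : X y -> y <> r -> E.`2 y.
    move=> /reach[m /iterate_chain[t [_]]].
    case/lastP: t => [|t z] /=; first by move=> _ ->.
    by move=> /chain_rcons[_ El]; rewrite last_rcons => <- _; exists (last r t).
  have in1 : E.`1 r.
    (* Nontriviality supplies a node other than [r]; the first edge on the way to it leaves [r]. *)
    have [z Xz zr] : exists2 z, X z & z <> r.
      have [xr|] := pselect (x = r); last by exists x.
      by exists x' => // x'r; apply: xx'; rewrite xr.
    have [m /iterate_chain[[|z' t] [_ /= Et lt]]] := reach _ Xz.
      by case: zr.
    by exists z'; case: Et.
  split=> //.
  - apply/seteqP; split=> [y Xy|y [] [z /EX[]] //].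
    have [->|/(in2 _ Xy)] := pselect (y = r); [by left|by right].
  - exists r; apply/seteqP; split=> [y [[z /EX[/= Xy _]] yNE]|y ->] //.
    by apply: contrapT => /(in2 _ Xy).
  - move=> y Ey; have Xy : X y by case: Ey => z /EX[].
    have [[|m] it] := reach _ Xy; last by exists m.+1, r.
    by case: rNE; rewrite it.
have EX : digraph X E by rewrite XE => -[x y] Exy; split; [left; exists y|right; exists x].
have [[y Ery] rNE] : (E.`1 `\` E.`2) r by rewrite rE.
split; last first.
  exists r, y; have [Xr Xy] := EX _ Ery; split=> // ry.
  by apply: rNE; exists r; rewrite {2}ry.
split=> //; exists r; apply/is_rootP => //; split=> //.
  by have [] := EX _ Ery.
move=> x; have [xE _|xNE] := pselect (E.`2 x).
  have [[|m] [z [//]]] := reach _ xE.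
  move=> _ it zNE; exists m.+1; suff <- : z = r by [].
  have : (E.`1 `\` E.`2) z by split=> //; case: it => z' [_ ?]; exists z'.
  by rewrite rE.
rewrite XE => -[xE|//]; exists 0 => /=; apply/esym.
(* At least one step was taken, so [z] has a successor; having no predecessor, it must be [r]. *)
by have : (E.`1 `\` E.`2) x by []; rewrite rE.
Qed.

End OutTreeTheory.

(** * The out-tree of a quintuple set *)

Section Projections.
Context {Player Sit Node Action : Type}.
Implicit Type Q : set (quintuple Player Sit Node Action).

Lemma pi_WY_fst Q : (pi_WY Q).`1 = pi_W Q.
Proof.
apply/seteqP; split=> w; first by case=> y [q Qq [<- _]]; exists q.
by case=> q Qq <-; exists (successor q), q.
Qed.

Lemma pi_WY_snd Q : (pi_WY Q).`2 = pi_Y Q.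
Proof.
apply/seteqP; split=> y; first by case=> w [q Qq [_ <-]]; exists q.
by case=> q Qq <-; exists (decision q), q.
Qed.

Lemma flip_pi_WY Q : flip (pi_WY Q) = pi_YW Q.
Proof.
by apply/seteqP; split=> -[y w] [q Qq [<- <-]]; exists q.
Qed.

Lemma pi_WI_snd Q : (pi_WI Q).`2 = pi_I Q.
Proof.
apply/seteqP; split=> i; first by case=> w [q Qq [_ <-]]; exists q.
by case=> q Qq <-; exists (decision q), q.
Qed.

Lemma pentaform_tree Q : nontrivial_out_tree (pentaform_nodes Q) (pi_WY Q) <->
  [/\ is_singleton (pi_W Q `\` pi_Y Q), is_function (pi_YW Q) &
      forall y, pi_Y Q y -> exists m x,
        [/\ (1 <= m)%N, iterate (pi_YW Q) m y x & ~ pi_Y Q x]].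
Proof.
have := nontrivial_out_treeP (pentaform_nodes Q) (pi_WY Q).
rewrite pi_WY_fst pi_WY_snd flip_pi_WY => ->.
by split=> -[].
Qed.

End Projections.

(** * From traditional games to pentaform games *)

Section TraditionalToPentaform.
Context {R : realType} {Player Node Action : Type}.
Variable G : traditional_tuple R Player Node Action.
Hypothesis tradG : traditional_game G.

Let Q := quintuples (opP G).

Let opPE i H w a y : Q (Quintuple i H w a y) <->
  [/\ edges G (w, y), control G (w, i), infosets G H /\ H w &
      labels G ((w, y), a)].
Proof.
split=> [[i' [H' [w' [a' [y' [? ? ? ? [-> -> -> -> ->]]]]]]] //|[? ? ? ?]].
by exists i, H, w, a, y.
Qed.

(** No edge is lost, since [control] and [labels] are total on their domains and the information
    sets cover the decision nodes. *)
Lemma opP_complete w y : edges G (w, y) ->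
  exists i H a, Q (Quintuple i H w a y).
Proof.
move=> Ewy; have E1w : (edges G).`1 w by exists y.
have [[_ domc] _] := T5 tradG; have [[_ doml] _] := T3 tradG.
have [cov _ _] := T2 tradG.
have [i ci] : (control G).`1 w by rewrite domc.
have [a la] : (labels G).`1 (w, y) by rewrite doml.
have [H HG Hw] : cover (infosets G) id w by rewrite cov.
by exists i, H, a; apply/opPE.
Qed.

Lemma infoset_unique H H' w :
  infosets G H -> infosets G H' -> H w -> H' w -> H = H'.
Proof.
by move=> HG HG' Hw H'w; have [_ triv _] := T2 tradG; apply: triv => //; exists w.
Qed.

Lemma infoset_edge H w : infosets G H -> H w -> exists y, edges G (w, y).
Proof.
move=> HG Hw; have [cov _ _] := T2 tradG.
by have : (edges G).`1 w by rewrite -cov; exists H.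
Qed.

Lemma opP_WY : pi_WY Q = edges G.
Proof.
apply/seteqP; split=> [_ [[i H w a y] /opPE[? _ _ _] <-] //|[w y]].
by move=> /opP_complete[i [H [a Qq]]]; exists (Quintuple i H w a y).
Qed.

Lemma opP_nodes : pentaform_nodes Q = nodes G.
Proof.
have /nontrivial_out_treeP[-> _ _ _] := T1 tradG.
by rewrite -opP_WY pi_WY_fst pi_WY_snd.
Qed.

Lemma opP_WI : pi_WI Q = control G.
Proof.
have [[_ domc] _] := T5 tradG; have [[_ doml] _] := T3 tradG.
have [cov _ _] := T2 tradG.
apply/seteqP; split=> [_ [[i H w a y] /opPE[_ ? _ _] <-] //|[w i] ci].
have [y Ewy] : (edges G).`1 w by rewrite -domc; exists i.
have [a la] : (labels G).`1 (w, y) by rewrite doml.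
have [H HG Hw] : cover (infosets G) id w by rewrite cov; exists y.
by exists (Quintuple i H w a y) => //; apply/opPE.
Qed.

Lemma opP_WY_A : pi_WY_A Q = labels G.
Proof.
have [[_ domc] _] := T5 tradG; have [[_ doml] _] := T3 tradG.
have [cov _ _] := T2 tradG.
apply/seteqP; split=> [_ [[i H w a y] /opPE[_ _ _ ?] <-] //|[[w y] a] la].
have Ewy : edges G (w, y) by rewrite -doml; exists a.
have [i ci] : (control G).`1 w by rewrite domc; exists y.
have [H HG Hw] : cover (infosets G) id w by rewrite cov; exists y.
by exists (Quintuple i H w a y) => //; apply/opPE.
Qed.

(** A cell is nonempty, so some edge leaves it; by disjointness the resulting quintuple has that
    very cell as its situation. *)
Lemma opP_J : pi_J Q = infosets G.
Proof.
apply/seteqP; split=> [_ [[i H w a y] /opPE[_ _ [? _] _] <-] //|H HG].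
have [_ _ nz] := T2 tradG; have [w /= Hw] := nz _ HG.
have [y /opP_complete[i [H' [a Qq]]]] := infoset_edge HG Hw.
exists (Quintuple i H' w a y) => //=.
by have /opPE[_ _ [HG' H'w] _] := Qq; exact: infoset_unique H'w Hw.
Qed.

Lemma opP_W_slice H : infosets G H -> pi_W (slice Q H) = H.
Proof.
move=> HG; apply/seteqP; split=> [_ [[i H' w a y] [/opPE[_ _ [_ H'w] _] /= <-] <-] //|w Hw].
have [y /opP_complete[i [H' [a Qq]]]] := infoset_edge HG Hw.
have /opPE[_ _ [HG' H'w] _] := Qq.
by exists (Quintuple i H' w a y) => //; split=> //; exact: infoset_unique H'w Hw.
Qed.

Lemma opP_pentaform : pentaform Q.
Proof.
have [[funl _] linj] := T3 tradG; have [[func _] Hctrl] := T5 tradG.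
have := T1 tradG; rewrite -opP_nodes -opP_WY.
move=> /pentaform_tree[root1 predQ reach]; split=> //.
- move=> j i i' [[i1 H1 w1 a1 y1] /opPE[_ c1 [HG H1w] _] [<- <-]].
  move=> [[i2 H2 w2 a2 y2] /opPE[_ c2 [_ H2w] _] /= [H21 <-]].
  by rewrite H21 in H2w; exact: Hctrl H1w H2w c1 c2.
- move=> w j j' [[i1 H1 w1 a1 y1] /opPE[_ _ [HG1 H1w] _] [<- <-]].
  move=> [[i2 H2 w2 a2 y2] /opPE[_ _ [HG2 H2w] _] /= [w21 <-]].
  by rewrite w21 in H2w; exact: infoset_unique H1w H2w.
- move=> H; rewrite opP_J => HG.
  have [_ _ nz] := T2 tradG; have [w0 /= Hw0] := nz _ HG.
  (* By [T4] all nodes of [H] have the feasible set of [w0], which is therefore the second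
     factor. *)
  exists H, (feasible (edges G) (labels G) w0); apply/seteqP; split.
    move=> _ [[i H' w a y] [/opPE[Ewy _ [_ H'w] la] /= H'H] <-].
    by rewrite H'H in H'w; split=> //=; rewrite (T4 tradG HG Hw0 H'w); exists y.
  move=> [w a] [/= Hw]; rewrite (T4 tradG HG Hw0 Hw) => -[y Ewy la].
  have [i [H' [a' /opPE[_ ci [HG' H'w] _]]]] := opP_complete Ewy.
  by exists (Quintuple i H w a y) => //; split=> //; apply/opPE.
(* [Pway] is the contrapositive of local injectivity. *)
- move=> wa y y' [[i1 H1 w1 a1 y1] /opPE[E1 _ _ l1] [<- <-]].
  move=> [[i2 H2 w2 a2 y2] /opPE[E2 _ _ l2] /= [w21 a21 <-]].
  rewrite w21 a21 in E2 l2; apply: contrapT => yy.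
  exact: (linj _ _ _ _ _ E1 E2 yy l1 l2).
- move=> y a a' [[i1 H1 w1 a1 y1] Q1 [<- <-]] [[i2 H2 w2 a2 y2] Q2 /= [y21 <-]].
  (* Labels depend on edges, so [Pay] first needs the unique predecessor of the common successor. *)
  have w12 : w1 = w2.
    apply: (predQ y1); [by exists (Quintuple i1 H1 w1 a1 y1)|].
    by exists (Quintuple i2 H2 w2 a2 y2) => //=; rewrite y21.
  have /opPE[_ _ _ l1] := Q1; have /opPE[_ _ _ l2] := Q2.
  by rewrite -w12 y21 in l2; exact: funl l1 l2.
Qed.

Lemma opP_game : infoset_pentaform_game (opP G).
Proof.
split; last by move=> H; rewrite opP_J; exact: opP_W_slice.
split; first exact: opP_pentaform.
rewrite -/Q opP_nodes opP_WY -pi_WI_snd opP_WI; exact: T6 tradG.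
Qed.

Lemma opPK : opT (opP G) = G.
Proof.
rewrite /opT -/Q opP_nodes opP_WY opP_WY_A opP_WI opP_J.
suff -> : [set pi_W (slice Q j) | j in infosets G] = infosets G by case: (G).
apply/seteqP; split=> [_ [H HG <-]|H HG]; first by rewrite opP_W_slice.
by exists H => //; exact: opP_W_slice.
Qed.

End TraditionalToPentaform.

(** * From pentaform games to traditional games *)

Section PentaformToTraditional.
Context {R : realType} {Player Node Action : Type}.

Lemma opT_game {Sit : Type} (G : pentaform_couple R Player Sit Node Action) :
  pentaform_game G -> traditional_game (opT G).
Proof.
move=> []; set Q := quintuples G => pentaQ utilG.
have [ij jw wa way wy ay reach root1] := pentaQ.
have sit_eq q q' : Q q -> Q q' -> decision q = decision q' ->
    situation q = situation q'.
  move=> Qq Qq' qq'; apply: (jw (decision q)); first by exists q.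
  by exists q' => //; rewrite qq'.
have player_eq q q' : Q q -> Q q' -> situation q = situation q' ->
    player q = player q'.
  move=> Qq Qq' qq'; apply: (ij (situation q)); first by exists q.
  by exists q' => //; rewrite qq'.
split; rewrite /= -/Q ?pi_WY_fst.
- by apply/pentaform_tree.
- split.
  + apply/seteqP; split=> [w [_ [j _ <-]] [q [Qq _] <-]|w [q Qq <-]].
      by exists q.
    exists (pi_W (slice Q (situation q))); last by exists q.
    by exists (situation q) => //; exists q.
  (* Two cells sharing a node come from the same situation by [Pjw]. *)
  + move=> _ _ [j _ <-] [j' _ <-] [w [[q [Qq <-] <-] [q' [Qq' <-] qq']]].
    by rewrite (sit_eq _ _ Qq' Qq).
  + by move=> _ [j [q Qq qj] <-]; exists (decision q), q.
- split; first split.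
  + move=> wy' a a' [q Qq [<- <-]] [q' Qq' [[_ yy] <-]].
    by apply: (ay (successor q)); [exists q|exists q' => //; rewrite yy].
  + apply/seteqP; split=> [wy' [a [q Qq [<- _]]]|_ [q Qq <-]]; first by exists q.
    by exists (action q), q.
  + move=> w y1 y2 a1 a2 _ _ yy [q1 Q1 [<- e1 <-]] [q2 Q2 [w21 e2 <-]] a12.
    apply: yy; apply: (way (decision q1, action q1)).
      by exists q1 => //; rewrite e1.
    by exists q2 => //; rewrite a12 w21 e2.
(* By [Pjw] every quintuple through [w] lies in the slice of [j], so the feasible set is a section
   of [pi_WA (slice Q j)]; sections of a product over points of its first factor coincide. *)
- have feasE j w : pi_W (slice Q j) w -> feasible (pi_WY Q) (pi_WY_A Q) w =
      [set a | pi_WA (slice Q j) (w, a)].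
    move=> [q0 [Q0 <-] <-]; apply/seteqP; split=> a.
      move=> [y _ [q Qq [qw _ <-]]].
      by exists q; [split=> //; exact: sit_eq|rewrite qw].
    move=> [q [Qq _] [<- <-]].
    by exists (successor q); exists q.
  move=> _ w1 w2 [j Jj <-] W1 W2; rewrite (feasE j w1)// (feasE j w2)//.
  have [B [C BC]] := wa j Jj; rewrite BC.
  have inB w : pi_W (slice Q j) w -> B w.
    move=> [q Qq <-]; have : pi_WA (slice Q j) (decision q, action q) by exists q.
    by rewrite BC => -[].
  by apply/seteqP; split=> a /= [_ Ca]; split=> //; exact: inB.
- split; first split.
  + move=> w i i' [q Qq [<- <-]] [q' Qq' [ww <-]].
    by apply: player_eq => //; exact: sit_eq.
  + apply/seteqP; split=> [w [i [q Qq [<- _]]]|_ [q Qq <-]]; first by exists q.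
    by exists (player q), q.
  + move=> _ w1 w2 i1 i2 [j _ <-] [q1 [Q1 s1] d1] [q2 [Q2 s2] d2].
    move=> [q3 Q3 [d3 <-]] [q4 Q4 [d4 <-]]; apply: player_eq => //.
    rewrite (sit_eq _ _ Q3 Q1) ?d3//(sit_eq _ _ Q4 Q2) ?d4//.
    by rewrite s1 s2.
- by rewrite pi_WI_snd.
Qed.

(** The inclusion to check is that no new quintuple arises when player, situation and action are
    recombined from different quintuples with decision node [w]. [Pjw] gives these a common
    situation and [Pij] a common player, so the recombined one is already [q2]. *)
Lemma opTK (G : pentaform_couple R Player (set Node) Node Action) :
  infoset_pentaform_game G -> opP (opT G) = G.
Proof.
case: G => Q u [[/= [ij jw _ _ _ _ _ _] _] infoQ]; rewrite /opP /opT /=.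
congr PentaformCouple; apply/seteqP; split; last first.
  move=> [i j w a y] Qq; set q := Quintuple _ _ _ _ _ in Qq.
  exists i, j, w, a, y; split=> //; try by exists q.
  have Jj : pi_J Q j by exists q.
  by split; [exists j => //; exact: infoQ|rewrite -(infoQ _ Jj); exists q].
move=> _ [i [H [w [a [y [_ [q1 Q1 [w1 <-]] [[j Jj <-] Wjw] [q2 Q2 [w2 y2 a2]] ->]]]]]].
have [q3 [Q3 j3] w3] := Wjw.
(* The cell [W_j] produced by [opT] is turned back into [j]. *)
rewrite (infoQ _ Jj).
have sit_eq q : Q q -> decision q = w -> situation q = j.
  move=> Qq qw; apply: (jw w); first by exists q => //; rewrite qw.
  by exists q3 => //; rewrite w3 j3.
have -> : player q1 = player q2.
  by apply: (ij j); [exists q1|exists q2] => //; rewrite sit_eq.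
rewrite -(sit_eq _ Q2 w2) -w2 -a2 -y2.
by case: (q2) Q2.
Qed.

End PentaformToTraditional.

Theorem theorem5p4 (R : realType) (Player Node Action : Type) :
  let Trad : set (traditional_tuple R Player Node Action) :=
    [set G | traditional_game G] in
  let Penta : set (pentaform_couple R Player (set Node) Node Action) :=
    [set G | infoset_pentaform_game G] in
  set_bij Trad Penta (@opP R Player Node Action) /\
  [/\ set_fun Penta Trad (@opT R Player (set Node) Node Action),
      forall G, Trad G -> opT (opP G) = G &
      forall G, Penta G -> opP (opT G) = G].
Proof.
move=> Trad Penta.
have opP_fun G : Trad G -> Penta (opP G) by exact: opP_game.
have opT_fun G : Penta G -> Trad (opT G) by case=> /opT_game.
have opP_can G : Trad G -> opT (opP G) = G by exact: opPK.
have opT_can G : Penta G -> opP (opT G) = G by exact: opTK.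
split; [split|split] => //.
- by move=> G G' /set_mem TG /set_mem TG' GG'; rewrite -(opP_can _ TG) GG' opP_can.
- by move=> G PG; exists (opT G); [exact: opT_fun|exact: opT_can].
Qed.
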